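(* Let $M$ and $N$ be subspaces of $\mathbb{C}^{2p}$ in generic position (so $\dim M=\dim N=p$), and let $P$ and $Q$ be the orthogonal projections onto $M$ and $N$, respectively. Let $\theta_1,\dots,\theta_p$ be the principal angles between $M$ and $N$, let $J_1,\dots,J_p$ be the associated Jordan planes, and put $\lambda_k=\cos\theta_k$, $\mu_k=\sin\theta_k$. Then the numerical range of $PQ$ is the convex hull of the union of the numerical ranges of the restrictions of $PQ$ to the Jordan planes, which are elliptical disks: $$W(PQ)=\operatorname{Conv}\Big(\bigcup_{k=1}^p W(PQ|_{J_k})\Big)=\operatorname{Conv}\left(\bigcup_{k=1}^{p}\left\{x+iy\in\mathbb{C}:\ \frac{\left(x-\frac{\lambda_k^2}{2}\right)^2}{\frac{\lambda_k^2}{4}}+\frac{y^2}{\frac{\lambda_k^2\mu_k^2}{4}}\le 1\right\}\right),$$ where in the second set $x,y$ are real.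
   Context: Two subspaces $M,N$ of $\mathbb{C}^n$ are in generic position if $M\cap N$, $M\cap N^{\perp}$, $M^{\perp}\cap N$, $M^{\perp}\cap N^{\perp}$ are all zero; then $n=2p$ is even and $\dim M=\dim N=\dim M^\perp=\dim N^\perp=p$. Principal angles and vectors: for subspaces $M,N$ of $\mathbb{C}^n$ with $\dim M=p\ge q=\dim N$, the principal angles $\theta_1,\dots,\theta_q\in[0,\pi/2]$ are defined recursively, with $M_0=N_0=\{0\}$, by $\cos\theta_i=\sup\{|\langle u,v\rangle|: u\in M\cap M_{i-1}^{\perp},\ v\in N\cap N_{i-1}^{\perp},\ \|u\|=\|v\|=1\}=\langle u_i,v_i\rangle$ for some chosen unit vectors $u_i\in M\cap M_{i-1}^{\perp}$, $v_i\in N\cap N_{i-1}^{\perp}$, where $M_{i}=\operatorname{span}\{u_1,\dots,u_{i}\}$ and $N_{i}=\operatorname{span}\{v_1,\dots,v_{i}\}$. The $u_i,v_i$ are called principal vectors; the angles are uniquely determined by $M,N$, the vectors are not. If $0<\theta_k<\pi/2$, the $k$-th Jordan plane is $J_k=\operatorname{span}\{u_k,v_k\}$, which is two-dimensional. In generic position all $\theta_k\in(0,\pi/2)$, so there are $p$ Jordan planes. Each $J_k$ is invariant under the orthogonal projections onto $M$ and $N$, so $PQ|_{J_k}$ is an operator on $J_k$. The numerical range of an operator $A$ on a finite-dimensional complex inner product space $H$ is $W(A)=\{\langle Ax,x\rangle: x\in H,\ \|x\|=1\}$. $\operatorname{Conv}(E)$ denotes the convex hull of $E\subset\mathbb{C}$.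 *)

(* Defs.v *)
From HB Require Import structures.
From mathcomp Require Import all_boot all_order all_algebra.
From mathcomp Require Import sesquilinear spectral complex.
From mathcomp Require Import boolp classical_sets reals trigo convex.

Set Implicit Arguments.
Unset Strict Implicit.
Unset Printing Implicit Defensive.

Import Order.TTheory GRing.Theory Num.Theory Normc.

Local Open Scope ring_scope.
Local Open Scope complex_scope.
Local Open Scope classical_set_scope.

(* The inner product of C^n is [dotmx] (linear in its left argument), C being
   [R[i]] for a complete ordered field R. Subspaces are row spaces of square
   matrices, and vectors are rows, on which matrices act on the right. *)

(* Same term as the section-local notation of spectral.v, so that its lemmas
   on orthogonal complements apply. *)
Notation "B ^!" :=
  (orthomx Num.conj (mx_of_hermitian (hermitian1mx _)) B) : matrix_set_scope.

Section Definitions.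
Variable R : realType.
Local Notation C := R[i].

Definition generic_position n (M N : 'M[C]_n) : Prop :=
  [/\ (M :&: N = 0)%MS, (M :&: N^! = 0)%MS,
      (M^! :&: N = 0)%MS & (M^! :&: N^! = 0)%MS].

(* |x|^2 = 1 *)
Definition unit_vector n (x : 'rV[C]_n) : Prop := dotmx x x = 1.

(* The set whose supremum is the cosine of the first angle between M and N. *)
Definition unit_overlaps n (M N : 'M[C]_n) : set R :=
  [set r | exists x y : 'rV[C]_n,
    [/\ (x <= M)%MS /\ unit_vector x, (y <= N)%MS /\ unit_vector y
      & r = normc (dotmx x y)]].

Definition span_before n q (w : 'I_q -> 'rV[C]_n) (i : 'I_q) : 'M[C]_n :=
  (\sum_(j < q | (j < i)%N) <<w j>>)%MS.

(* theta lists the principal angles between M and N, with principal vectors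
   u and v; the indices are shifted to start at 0. *)
Record principal_system n (M N : 'M[C]_n) q
    (theta : 'I_q -> R) (u v : 'I_q -> 'rV[C]_n) : Prop := PrincipalSystem {
  principal_rank : \rank N = q /\ (\rank N <= \rank M)%N;
  principal_angle : forall i, 0 <= theta i <= pi / 2;
  principal_left : forall i,
    (u i <= M :&: (span_before u i)^!)%MS /\ unit_vector (u i);
  principal_right : forall i,
    (v i <= N :&: (span_before v i)^!)%MS /\ unit_vector (v i);
  principal_sup : forall i,
    cos (theta i) = sup (unit_overlaps (M :&: (span_before u i)^!)%MS
                                       (N :&: (span_before v i)^!)%MS);
  principal_dot : forall i, dotmx (u i) (v i) = (cos (theta i))%:C }.

Definition jordan_plane n q (u v : 'I_q -> 'rV[C]_n) (k : 'I_q) : 'M[C]_n :=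
  (u k + v k)%MS.

(* For a subspace H invariant under f, this is W(f|_H); [1%:M] is C^n. *)
Definition numerical_range n (f : 'rV[C]_n -> 'rV[C]_n) (H : 'M[C]_n) : set C :=
  [set dotmx (f x) x | x in [set x | (x <= H)%MS /\ unit_vector x]].

(* [Rcomplex R] is R[i] as a vector space over R. *)
Definition convex_hull (E : set C) : set C :=
  smallest (@convex_set R (Rcomplex R)) E.

Definition elliptical_disk (lambda mu : R) : set C :=
  [set z | let: x +i* y := z in
    (x - lambda ^+ 2 / 2) ^+ 2 / (lambda ^+ 2 / 4)
      + y ^+ 2 / (lambda ^+ 2 * mu ^+ 2 / 4) <= 1].

End Definitions.

(* Main.v *)
Require Import Defs.
From mathcomp Require Import all_boot all_order all_algebra.
From mathcomp Require Import sesquilinear spectral complex.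
From mathcomp Require Import boolp classical_sets reals trigo convex.
From mathcomp Require Import interval_inference ring lra.

(** A vector x of C^n split as a sum of x_k in pairwise orthogonal subspaces H_k
    invariant under f satisfies |x|^2 = sum |x_k|^2 and
    <f x, x> = sum <f x_k, x_k>, so the value <f x, x> at a unit vector is the
    convex combination, with weights |x_k|^2, of values of the restrictions
    f|H_k. Conversely, convex combinations of points of the W(f|H_k) are
    attained as soon as each W(f|H_k) is convex, because the points with the
    same index k can then be merged into one. This is [numerical_range_orthogonal_sum]; the
    bookkeeping of weights, some of which may vanish, is done with [cone], the
    convex cone over a convex set E, which consists of the pairs (r, r w) with
    r >= 0 and w in E.

    For projections in generic position the H_k are the Jordan planes. Their
    mutual orthogonality is the orthogonality of u_i and v_j for distinct i and
    j ([principal_dot_neq]), which holds because otherwise, say for i < j, turning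
    v_i towards v_j would give a larger overlap with u_i than cos theta_i,
    against the maximality in the choice of v_i ([maximal_overlap_ortho]). As the u_i
    and the v_i are orthonormal bases of M and N, the planes then fill the whole
    space, and on the k-th one Q u_k = cos theta_k v_k and
    P v_k = cos theta_k u_k.

    In the orthonormal basis of a Jordan plane that starts with u_k, the values
    of the quadratic form of PQ are c (c a + s b) conj a with
    |a|^2 + |b|^2 = 1, where c and s are the cosine and the sine of theta_k. The
    real numbers |a|^2 - |b|^2, 2 Re (b conj a) and 2 Im (b conj a) run over the
    unit sphere of R^3, so the numerical range is the image of that sphere under
    an affine map onto the plane, an elliptical disk ([elliptical_diskP]), which
    is convex. *)

Set Implicit Arguments.
Unset Strict Implicit.
Unset Printing Implicit Defensive.

Import Order.TTheory GRing.Theory Num.Theory Normc.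

Local Open Scope ring_scope.
Local Open Scope classical_set_scope.

(** * Convex sets of complex numbers and the cones over them *)

Section ConvexCone.
Variable R : realType.
Local Notation C := R[i].
Implicit Types (E F : set C) (r s t : R) (z w : C).
Local Open Scope complex_scope.

Lemma convex_setP E :
  @convex_set R (Rcomplex R) E <->
  forall s t z w, 0 <= s -> 0 <= t -> s + t = 1 -> E z -> E w ->
    E (s%:C * z + t%:C * w).
Proof.
have scaleE t z : t *: (z : Rcomplex R) = t%:C * z.
  by case: z => a b; congr (_ +i* _); rewrite mul0r ?subr0 ?addr0.
split=> [cvxE s t z w s0 t0 st1 Ez Ew|cvxE z w s /set_mem Ez /set_mem Ew].
  have s1 : s <= 1 by rewrite -st1 lerDl.
  have := cvxE z w (Itv01 s0 s1) (mem_set Ez) (mem_set Ew).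
  have -> : t = 1 - s by rewrite -st1 addrAC subrr add0r.
  by rewrite -!scaleE inE.
apply/mem_set; have := cvxE s%:num (1 - s%:num) z w.
by rewrite -!scaleE; apply; rewrite // ?subr_ge0 // addrCA subrr addr0.
Qed.

(** Only a positive weight forces the point w to lie in E, so that the apex
    (0, 0) belongs to the cone over the empty set too. *)
Definition cone E r z : Prop :=
  0 <= r /\ exists2 w, (0 < r -> E w) & z = r%:C * w.

Lemma cone1 E z : cone E 1 z <-> E z.
Proof.
split=> [[_ [w Ew ->]]|Ez]; first by rewrite mul1r; exact: Ew.
by split; last by exists z; rewrite ?mul1r.
Qed.

Lemma cone0 E : cone E 0 0.
Proof. by split=> //; exists 0; rewrite ?ltxx ?mulr0. Qed.

Lemma coneS E F r z : E `<=` F -> cone E r z -> cone F r z.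
Proof. by move=> EF [r0 [w Ew ->]]; split=> //; exists w => // /Ew /EF. Qed.

Lemma coneZ E r z t : 0 <= t -> cone E r z -> cone E (t * r) (t%:C * z).
Proof.
move=> t0 [r0 [w Ew ->]]; split; first exact: mulr_ge0.
exists w; last by rewrite rmorphM mulrA.
by move=> tr0; apply: Ew; rewrite lt_neqAle r0 eq_sym andbT; apply/eqP => rE;
  rewrite rE mulr0 ltxx in tr0.
Qed.

(** If z = r z' and w = s w' with z' and w' in E, then z + w is r + s times the
    average of z' and w' with weights r / (r + s) and s / (r + s), which lies in
    the convex set E. *)
Lemma coneD E r s z w : @convex_set R (Rcomplex R) E ->
  cone E r z -> cone E s w -> cone E (r + s) (z + w).
Proof.
move=> /convex_setP cvxE [r0 [z' Ez ->]] [s0 [w' Ew ->]].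
split; first exact: addr_ge0.
have [->|rN0] := eqVneq r 0; first by exists w'; rewrite ?add0r // mul0r add0r.
have [->|sN0] := eqVneq s 0; first by exists z'; rewrite ?addr0 // mul0r addr0.
have {}r0 : 0 < r by rewrite lt_neqAle eq_sym rN0.
have {}s0 : 0 < s by rewrite lt_neqAle eq_sym sN0.
have rs0 : 0 < r + s by exact: addr_gt0.
exists ((r / (r + s))%:C * z' + (s / (r + s))%:C * w').
  move=> _; apply: cvxE (Ez r0) (Ew s0); rewrite ?divr_ge0 ?ltW //.
  by rewrite -mulrDl divff // gt_eqF.
by rewrite mulrDr !mulrA -!rmorphM ![(r + s) * _]mulrC !divfK ?gt_eqF.
Qed.

Lemma cone_sum E (I : finType) (r : I -> R) (z : I -> C) :
  @convex_set R (Rcomplex R) E -> (forall i, cone E (r i) (z i)) ->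
  cone E (\sum_i r i) (\sum_i z i).
Proof.
move=> cvxE Ez; elim/big_ind2: _ => [|r1 z1 r2 z2|//]; first exact: cone0.
exact: coneD.
Qed.

Lemma sub_convex_hull E : E `<=` convex_hull E.
Proof. exact: sub_smallest. Qed.

Lemma convex_convex_hull E : @convex_set R (Rcomplex R) (convex_hull E).
Proof.
apply/convex_setP => s t z w s0 t0 st1 Ez Ew F [cvxF EF].
by move/convex_setP: (cvxF); apply; [..|exact: Ez|exact: Ew].
Qed.

Lemma convex_hull_sub E F :
  @convex_set R (Rcomplex R) F -> E `<=` F -> convex_hull E `<=` F.
Proof. by move=> cvxF EF z; apply. Qed.

End ConvexCone.

(** * Numerical range of an orthogonal sum *)

Section NumericalRange.
Variables (R : realType) (n : nat).
Local Notation C := R[i].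
Implicit Types (x y z : 'rV[C]_n) (H : 'M[C]_n).
Local Open Scope complex_scope.

Lemma dotmx_lincombl (a b : C) x y z :
  dotmx (a *: x + b *: y) z = a * dotmx x z + b * dotmx y z.
Proof. by rewrite linearDl !linearZl_LR. Qed.

Lemma dotmx_lincombr (a b : C) x y z :
  dotmx z (a *: x + b *: y) = conjc a * dotmx z x + conjc b * dotmx z y.
Proof. by rewrite linearDr !linearZr_LR. Qed.

Lemma dotmxZreal (a b : R) x y :
  dotmx (a%:C *: x) (b%:C *: y) = (a * b)%:C * dotmx x y.
Proof.
rewrite linearZl_LR linearZr_LR /= -[Num.conj b%:C]/(conjc b%:C) conjc_real.
by rewrite mulrA -rmorphM.
Qed.

Lemma orthomx_dotP (m p : nat) (A : 'M[C]_(m, n)) (B : 'M[C]_(p, n)) :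
  reflect (forall x y, (x <= A)%MS -> (y <= B)%MS -> dotmx x y = 0)
          (A <= B^!)%MS.
Proof.
apply: (iffP idP) => [/orthomxP AB x y xA yB|AB].
  by apply/hermmx_eq0P; exact: AB.
by apply/orthomxP => x y xA yB; apply/hermmx_eq0P; exact: AB.
Qed.

Lemma dotmx_normsq_real x : exists2 r : R, 0 <= r & dotmx x x = r%:C.
Proof.
have: 0 <= dotmx x x by exact: dnorm_ge0.
by case: (dotmx x x) => a b; rewrite lecE /= => /andP[/eqP -> a0]; exists a.
Qed.

(** The quadratic form of f scales like the squared norm, so vectors of
    arbitrary norm give the cone over the numerical range. *)
Lemma cone_numerical_rangeP (f : {linear 'rV[C]_n -> 'rV[C]_n}) H
    (r : R) (z : C) :
  cone (numerical_range f H) r z <->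
  exists x, [/\ (x <= H)%MS, dotmx x x = r%:C & dotmx (f x) x = z].
Proof.
split=> [[r0 [w fw ->]]|[x [xH xr <-]]].
  have [->|rN0] := eqVneq r 0.
    by exists 0; rewrite sub0mx !linear0 !linear0l mul0r.
  case: fw => [|x [xH ux] <-]; first by rewrite lt_neqAle eq_sym rN0.
  exists ((Num.sqrt r)%:C *: x); rewrite scalemx_sub // linearZ.
  by rewrite !dotmxZreal -expr2 sqr_sqrtr // ux mulr1.
have r0 : 0 <= r by rewrite -(@lecR R) -xr dnorm_ge0.
split=> //; have [r_eq0|rN0] := eqVneq r 0.
  exists 0; first by rewrite r_eq0 ltxx.
  have /eqP : dotmx x x = 0 by rewrite xr r_eq0.
  by rewrite dnorm_eq0 => /eqP ->; rewrite linear0r mulr0.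
pose s : R := (Num.sqrt r)^-1.
have sE : s ^+ 2 = r^-1 by rewrite exprVn sqr_sqrtr.
exists ((s ^+ 2)%:C * dotmx (f x) x); last first.
  by rewrite mulrA -rmorphM sE mulfV // mul1r.
move=> _; exists (s%:C *: x); last by rewrite linearZ dotmxZreal -expr2.
split; first by rewrite scalemx_sub.
by rewrite /unit_vector dotmxZreal -expr2 sE xr -rmorphM mulVf.
Qed.

Lemma numerical_rangeS (f : 'rV[C]_n -> 'rV[C]_n) H (K : 'M[C]_n) :
  (H <= K)%MS -> numerical_range f H `<=` numerical_range f K.
Proof. by move=> HK z [x [/submx_trans/(_ HK) xK ux] <-]; exists x. Qed.

Section OrthogonalSum.
Variables (I : finType) (H : I -> 'M[C]_n).
Hypothesis orthoH : forall k l, k != l -> (H k <= (H l)^!)%MS.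

Lemma dotmx_orthogonal_sum (x y : I -> 'rV[C]_n) :
  (forall k, (x k <= H k)%MS) -> (forall k, (y k <= H k)%MS) ->
  dotmx (\sum_k x k) (\sum_k y k) = \sum_k dotmx (x k) (y k).
Proof.
move=> xH yH; rewrite linear_sumlz; apply: eq_bigr => k _.
rewrite linear_sumr (bigD1 k) //= big1 ?addr0 // => l lk.
rewrite eq_sym in lk; have /orthomx_dotP := orthoH lk; exact.
Qed.

(** The hull lies in the numerical range because the latter is convex: the
    components of two vectors in the same H k are merged, by additivity of the
    cone over the convex set W(f|H k), into a single vector of H k. *)
Theorem numerical_range_orthogonal_sum (f : {linear 'rV[C]_n -> 'rV[C]_n}) :
  (forall k x, (x <= H k)%MS -> (f x <= H k)%MS) ->
  (1%:M <= \sum_k H k)%MS ->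
  (forall k, @convex_set R (Rcomplex R) (numerical_range f (H k))) ->
  numerical_range f 1%:M = convex_hull (\bigcup_k numerical_range f (H k)).
Proof.
move=> invH sumH cvxH.
have decompose x : exists y : I -> 'rV[C]_n,
    (forall k, (y k <= H k)%MS) /\ x = \sum_k y k.
  have /sub_sumsmxP[y xE] := submx_trans (submx1 x) sumH.
  by exists (fun k => y k *m H k); split=> // k; exact: submxMl.
have dotf (y : I -> 'rV[C]_n) : (forall k, (y k <= H k)%MS) ->
    dotmx (f (\sum_k y k)) (\sum_k y k) = \sum_k dotmx (f (y k)) (y k).
  move=> yH; rewrite linear_sum dotmx_orthogonal_sum // => k.
  exact: invH.
rewrite eqEsubset; split.
  move=> _ [x [_ ux] <-]; have [y [yH xE]] := decompose x.
  have /fin_all_exists2[r r0 rE] k := dotmx_normsq_real (y k).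
  have sum_r : \sum_k r k = 1.
    apply: (@complexI R); rewrite rmorph1 -ux xE dotmx_orthogonal_sum //.
    by rewrite rmorph_sum; apply: eq_bigr => k _; rewrite rE.
  apply/cone1; rewrite xE dotf // -sum_r.
  apply: cone_sum => [|k]; first exact: convex_convex_hull.
  apply: (@coneS _ (numerical_range f (H k))).
    by apply: (subset_trans _ (@sub_convex_hull _ _)) => z fz; exists k.
  by apply/cone_numerical_rangeP; exists (y k).
apply: convex_hull_sub; last first.
  by move=> z [k _]; apply: numerical_rangeS; exact: submx1.
apply/convex_setP => s t _ _ s0 t0 st1 [x [_ ux] <-] [x' [_ ux'] <-].
have [y [yH xE]] := decompose x; have [y' [yH' xE']] := decompose x'.
have /fin_all_exists2[r r0 rE] k := dotmx_normsq_real (y k).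
have /fin_all_exists2[r' r0' rE'] k := dotmx_normsq_real (y' k).
(* The vector w k merges the k-th components of the two given vectors. *)
have /fin_all_exists[w wP] k : exists w, [/\ (w <= H k)%MS,
    dotmx w w = (s * r k + t * r' k)%:C &
    dotmx (f w) w =
      s%:C * dotmx (f (y k)) (y k) + t%:C * dotmx (f (y' k)) (y' k)].
  apply/cone_numerical_rangeP; apply: coneD; first exact: cvxH.
    by apply: coneZ => //; apply/cone_numerical_rangeP; exists (y k).
  by apply: coneZ => //; apply/cone_numerical_rangeP; exists (y' k).
have wH k : (w k <= H k)%MS by case: (wP k).
exists (\sum_k w k).
  split; rewrite ?submx1 // /unit_vector dotmx_orthogonal_sum //.
  transitivity (s%:C * dotmx x x + t%:C * dotmx x' x').
    rewrite xE xE' !dotmx_orthogonal_sum // !mulr_sumr -big_split.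
    by apply: eq_bigr => k _; case: (wP k) => _ -> _;
      rewrite rE rE' rmorphD !rmorphM.
  by rewrite ux ux' !mulr1 -rmorphD st1.
rewrite dotf // xE xE' !dotf // !mulr_sumr -big_split.
by apply: eq_bigr => k _; case: (wP k).
Qed.

End OrthogonalSum.
End NumericalRange.

(** * Elliptical disks *)

Section EllipticalDisk.
Variable R : realType.
Local Notation C := R[i].
Implicit Types l m : R.
Local Open Scope complex_scope.

(** The defect in the convexity inequality is s (1 - s) times the value of the
    quadratic form at the difference of the two points. *)
Lemma convex_ellipse (k1 k2 c s x y x' y' : R) :
  0 <= k1 -> 0 <= k2 -> 0 <= s -> 0 <= 1 - s ->
  (x - c) ^+ 2 * k1 + y ^+ 2 * k2 <= 1 ->
  (x' - c) ^+ 2 * k1 + y' ^+ 2 * k2 <= 1 ->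
  (s * x + (1 - s) * x' - c) ^+ 2 * k1 + (s * y + (1 - s) * y') ^+ 2 * k2 <= 1.
Proof.
move=> k1_ge0 k2_ge0 s0 t0; rewrite -!(subr_ge0 _ 1) => E E'.
have q_ge0 : 0 <= (x - x') ^+ 2 * k1 + (y - y') ^+ 2 * k2.
  by apply: addr_ge0; apply: mulr_ge0; rewrite ?sqr_ge0.
apply: le_trans (addr_ge0 (addr_ge0 (mulr_ge0 s0 E) (mulr_ge0 t0 E'))
  (mulr_ge0 (mulr_ge0 s0 t0) q_ge0)) _.
by rewrite le_eqVlt; apply/orP; left; apply/eqP; ring.
Qed.

Lemma convex_elliptical_disk l m :
  @convex_set R (Rcomplex R) (elliptical_disk l m).
Proof.
apply/convex_setP => s t [x y] [x' y'] s0 t0 st1.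
have {}st1 : t = 1 - s by lra.
rewrite st1 in t0 *.
rewrite /elliptical_disk /= !mul0r !subr0 !addr0.
apply: convex_ellipse => //; first by rewrite invr_ge0 divr_ge0 ?sqr_ge0.
by rewrite invr_ge0 -exprMn divr_ge0 ?sqr_ge0.
Qed.

(** In the normalized coordinates (A, V) the ellipse is the unit disk. The point
    (T, U, V) attached to (a, b), with T = |a|^2 - |b|^2 and
    U + iV = 2 b conj a, lies on the unit sphere, and A = l T + m U because
    2 |a|^2 = 1 + T. As (l, m) is a unit vector, (T, U, V) |-> (A, V) is an
    orthogonal projection, which maps the sphere onto the unit disk. *)
Lemma elliptical_diskP l m (z : C) : l != 0 -> m != 0 -> l ^+ 2 + m ^+ 2 = 1 ->
  elliptical_disk l m z <->
  exists a b : C, a * conjc a + b * conjc b = 1 /\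
    z = l%:C * (l%:C * a + m%:C * b) * conjc a.
Proof.
move=> l0 m0 lm1; case: z => x y; rewrite /elliptical_disk /=.
pose A := 2 * x / l - l; pose V := 2 * y / (l * m).
rewrite (_ : _ + _ = A ^+ 2 + V ^+ 2); last first.
  by rewrite /A /V; field; rewrite l0 m0.
split=> [AV1|[[a a'] [[b b'] [/eqP]]]]; last first.
  rewrite eq_complex /= => /andP[/eqP ab1 _] [xE yE].
  pose T := 2 * (a ^+ 2 + a' ^+ 2) - 1; pose U := 2 * (a * b + a' * b').
  have AE : A = l * T + m * U by rewrite /A /T /U xE; field.
  have VE : V = 2 * (a * b' - a' * b).
    by rewrite /V yE; field; rewrite l0 m0.
  have sphere : T ^+ 2 + U ^+ 2 + V ^+ 2 = 1.
    have {}ab1 : b ^+ 2 = 1 - a ^+ 2 - a' ^+ 2 - b' ^+ 2 by rewrite -ab1; ring.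
    by rewrite /T /U VE; ring: ab1.
  rewrite -subr_ge0 (_ : _ - _ = (m * T - l * U) ^+ 2) ?sqr_ge0 //.
  rewrite -sphere AE -[T ^+ 2]mul1r -[U ^+ 2]mul1r -lm1; ring.
(* D is the coordinate along the direction of projection that lifts (A, V) to
   the unit sphere. *)
pose D := Num.sqrt (1 - (A ^+ 2 + V ^+ 2)).
have DE : D ^+ 2 = 1 - A ^+ 2 - V ^+ 2.
  by rewrite sqr_sqrtr ?subr_ge0 // opprD addrA.
have {}lm1 : m ^+ 2 = 1 - l ^+ 2 by rewrite -lm1 addrC addKr.
pose T := l * A - m * D; pose U := m * A + l * D.
have sphere : T ^+ 2 + U ^+ 2 + V ^+ 2 = 1.
  by rewrite /T /U; ring: lm1 DE.
have AE : A = l * T + m * U by rewrite /T /U; ring: lm1.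
have xE : x = (l * (l * (1 + T) + m * U)) / 2.
  have -> : x = l * (A + l) / 2 by rewrite /A; field.
  by rewrite AE; field.
have yE : y = l * m * V / 2 by rewrite /V; field; rewrite l0 m0.
have T1 : 0 <= (1 + T) / 2.
  suff: -1 <= T by lra.
  have : T ^+ 2 <= 1 by have := sqr_ge0 U; have := sqr_ge0 V; lra.
  by move=> T2; rewrite leNgt; apply/negP => T1; nra.
pose t := Num.sqrt ((1 + T) / 2).
have tE : t ^+ 2 = (1 + T) / 2 by rewrite sqr_sqrtr.
(* The pole T = -1 is the case a = 0, in which b is determined only up to a
   phase. *)
have [t0|tN0] := eqVneq t 0.
  have TN1 : T = -1 by move: tE; rewrite t0 expr0n /=; lra.
  have [U0 V0] : U = 0 /\ V = 0.
    have : U ^+ 2 + V ^+ 2 = 0 by move: sphere; rewrite TN1; lra.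
    by move/eqP; rewrite paddr_eq0 ?sqr_ge0 // !sqrf_eq0 => /andP[/eqP ? /eqP].
  exists 0, 1; split; apply/eqP; rewrite eq_complex /=; apply/andP;
    by split; apply/eqP; rewrite ?xE ?yE ?TN1 ?U0 ?V0; ring.
exists t%:C, ((U / (2 * t)) +i* (V / (2 * t))).
split; apply/eqP; rewrite eq_complex /=; apply/andP; split; apply/eqP.
- rewrite [LHS](_ : _ = t ^+ 2 + (U ^+ 2 + V ^+ 2) / (4 * t ^+ 2)); last first.
    by field.
  have -> : U ^+ 2 + V ^+ 2 = 1 - T ^+ 2 by rewrite -sphere; ring.
  rewrite tE; field.
  by move: tN0; rewrite -sqrf_eq0 tE; lra.
- by field.
- rewrite [RHS](_ : _ = l * (l * t ^+ 2 + m * U / 2)); last by field.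
  by rewrite tE xE; field.
- by rewrite yE; field.
Qed.

End EllipticalDisk.

(** * Principal vectors *)

Section PrincipalVectors.
Variable R : realType.
Local Notation C := R[i].
Local Open Scope complex_scope.

Section InnerProduct.
Variable n : nat.
Implicit Types (x y v : 'rV[C]_n) (A B : 'M[C]_n).

Lemma dotmxC x y : dotmx x y = conjc (dotmx y x).
Proof. by rewrite hermC expr0 mul1r. Qed.

Lemma dotmx_eq0C x y : dotmx x y = 0 -> dotmx y x = 0.
Proof. by move=> xy0; rewrite dotmxC xy0 conjc0. Qed.

Lemma unit_vector_normalize x : x != 0 ->
  exists s x', [/\ unit_vector x', x = s%:C *: x' & (x' <= x)%MS].
Proof.
move=> x0; have [r r0 xr] := dotmx_normsq_real x.
have rN0 : r != 0.
  apply: contraNneq x0 => rE; have : dotmx x x == 0 by rewrite xr rE.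
  by rewrite dnorm_eq0.
have sN0 : Num.sqrt r != 0 by rewrite sqrtr_eq0 -ltNge lt_neqAle eq_sym rN0.
exists (Num.sqrt r), ((Num.sqrt r)^-1%:C *: x).
split; last exact: scalemx_sub.
  by rewrite /unit_vector dotmxZreal -expr2 xr -rmorphM exprVn sqr_sqrtr //
    mulVf.
by rewrite scalerA -rmorphM mulfV // scale1r.
Qed.

Lemma sqr_normc (z : C) : (normc z ^+ 2)%:C = z * conjc z.
Proof. by rewrite rmorphXn -normCK. Qed.

Lemma normc_ge0 (z : C) : 0 <= normc z.
Proof. by case: z => a b; exact: sqrtr_ge0. Qed.

Lemma unit_overlaps_ub A B : has_ubound (unit_overlaps A B).
Proof.
exists 1 => _ [x [y [[_ ux] [_ uy] ->]]].
have /= [] := CauchySchwarz (@dotmx C n) x y; rewrite ux uy mulr1 => + _.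
rewrite normCK -sqr_normc lecR expr_le1 //.
exact: normc_ge0.
Qed.

(** Homogeneity extends the bound from unit vectors to all vectors, which spares
    normalizing the trial vectors in variational arguments. *)
Lemma normsq_dotmx_le A B x y : (x <= A)%MS -> (y <= B)%MS ->
  dotmx x y * conjc (dotmx x y) <=
  (sup (unit_overlaps A B) ^+ 2)%:C * (dotmx x x * dotmx y y).
Proof.
move=> xA yB.
have [->|/unit_vector_normalize[s [x' [ux xE x'x]]]] := eqVneq x 0.
  by rewrite !linear0l !mul0r mulr0.
have [->|/unit_vector_normalize[t [y' [uy yE y'y]]]] := eqVneq y 0.
  by rewrite !linear0r mul0r !mulr0.
have le_sup : normc (dotmx x' y') <= sup (unit_overlaps A B).
  apply: ub_le_sup; first exact: unit_overlaps_ub.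
  by exists x', y'; rewrite (submx_trans x'x) // (submx_trans y'y).
rewrite xE yE !dotmxZreal ux uy !mulr1 -sqr_normc normcM -!rmorphM lecR.
rewrite exprMn [X in X * _](_ : _ = (s * t) ^+ 2); last first.
  by rewrite /= expr0n addr0 sqr_sqrtr ?sqr_ge0.
rewrite [s * s * _]mulrACA -expr2 [leRHS]mulrC.
apply: ler_wpM2l; first exact: sqr_ge0.
rewrite ler_sqr ?nnegrE ?normc_ge0 //.
by rewrite (le_trans _ le_sup) ?normc_ge0.
Qed.

(** Were d = <x, y> nonzero, then w = c v + d y, which satisfies
    <x, w> = <w, w> = c^2 + |d|^2, would have |w| > c and so overlap x more than
    c |w|. *)
Lemma maximal_overlap_ortho (c : R) x v y :
  unit_vector v -> unit_vector y -> dotmx x v = c%:C -> dotmx v y = 0 ->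
  (forall w, (w <= v + y)%MS ->
     dotmx x w * conjc (dotmx x w) <= (c ^+ 2)%:C * dotmx w w) ->
  dotmx x y = 0.
Proof.
have sum_eq0 (r s : R) : 0 <= r -> 0 <= s ->
    (r + s) * (r + s) <= r * (r + s) -> s = 0.
  move=> r0 s0 rs; apply/eqP; rewrite eq_le s0 andbT leNgt.
  by apply/negP => s_gt0; nra.
move=> uv uy xv vy bound.
have := bound (c%:C *: v + dotmx x y *: y).
rewrite addmx_sub_adds ?scalemx_sub // => /(_ isT).
set d := dotmx x y.
have -> : dotmx x (c%:C *: v + d *: y) = (c ^+ 2)%:C + d * conjc d.
  by rewrite dotmx_lincombr xv conjc_real rmorphXn expr2 mulrC
    [conjc d * _]mulrC.
have -> : dotmx (c%:C *: v + d *: y) (c%:C *: v + d *: y) =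
    (c ^+ 2)%:C + d * conjc d.
  rewrite dotmx_lincombl !dotmx_lincombr vy (dotmx_eq0C vy) uv uy.
  by rewrite conjc_real rmorphXn expr2 !mulr0 addr0 add0r !mulr1.
rewrite -(sqr_normc d) -rmorphD conjc_real -!rmorphM lecR => le_c.
apply: eq0_normc; apply/eqP; rewrite -sqrf_eq0; apply/eqP.
exact: (sum_eq0 (c ^+ 2)) (sqr_ge0 _) (sqr_ge0 _) le_c.
Qed.

Lemma span_before_orthoP q (w : 'I_q -> 'rV[C]_n) (i : 'I_q) x :
  reflect (forall j : 'I_q, (j < i)%N -> dotmx x (w j) = 0)
          (x <= (span_before w i)^!)%MS.
Proof.
rewrite orthomx_sym; apply: (iffP sumsmx_subP) => xw j ji.
  by have := xw j ji; rewrite genmxE orthomx_sym => /hermmx_eq0P.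
by rewrite genmxE orthomx_sym; apply/hermmx_eq0P; exact: xw.
Qed.

Lemma orthonormal_before q (w : 'I_q -> 'rV[C]_n) :
  (forall i, (w i <= (span_before w i)^!)%MS /\ unit_vector (w i)) ->
  forall i j, dotmx (w i) (w j) = (i == j)%:R.
Proof.
move=> wP i j; have [ji|ij|/val_inj ->] := ltngtP j i.
- by rewrite -val_eqE gtn_eqF //; case: (wP i) => /span_before_orthoP->.
- rewrite -val_eqE ltn_eqF //; apply: dotmx_eq0C.
  by case: (wP j) => /span_before_orthoP->.
- by rewrite eqxx; case: (wP i).
Qed.

End InnerProduct.

Variables (n q : nat) (M N : 'M[C]_n) (theta : 'I_q -> R).
Variables (u v : 'I_q -> 'rV[C]_n).
Hypothesis uvP : principal_system M N theta u v.

Lemma principal_left_dot i j : dotmx (u i) (u j) = (i == j)%:R.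
Proof.
apply: orthonormal_before => k; case: (principal_left uvP k) => uk ?.
by split=> //; apply: submx_trans uk (capmxSr _ _).
Qed.

Lemma principal_right_dot i j : dotmx (v i) (v j) = (i == j)%:R.
Proof.
apply: orthonormal_before => k; case: (principal_right uvP k) => vk ?.
by split=> //; apply: submx_trans vk (capmxSr _ _).
Qed.

Lemma principal_left_sub i : (u i <= M)%MS.
Proof.
by case: (principal_left uvP i) => /submx_trans-> //; exact: capmxSl.
Qed.

Lemma principal_right_sub i : (v i <= N)%MS.
Proof.
by case: (principal_right uvP i) => /submx_trans-> //; exact: capmxSl.
Qed.

(** The later principal vectors still compete at stage i, which is why the
    maximality at that stage constrains them. *)
Lemma principal_left_after (i j : 'I_q) : (i <= j)%N ->
  (u j <= M :&: (span_before u i)^!)%MS.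
Proof.
move=> ij; rewrite sub_capmx principal_left_sub.
apply/span_before_orthoP => k ki; rewrite principal_left_dot.
by rewrite -val_eqE gtn_eqF // (leq_trans ki).
Qed.

Lemma principal_right_after (i j : 'I_q) : (i <= j)%N ->
  (v j <= N :&: (span_before v i)^!)%MS.
Proof.
move=> ij; rewrite sub_capmx principal_right_sub.
apply/span_before_orthoP => k ki; rewrite principal_right_dot.
by rewrite -val_eqE gtn_eqF // (leq_trans ki).
Qed.

(** Maximality is used at the stage min i j: the vector with that index is
    fixed, and its partner is turned towards the vector with the larger index. *)
Lemma principal_dot_neq i j : i != j -> dotmx (u i) (v j) = 0.
Proof.
have unit_u k : unit_vector (u k) by case: (principal_left uvP k).
have unit_v k : unit_vector (v k) by case: (principal_right uvP k).
rewrite -val_eqE neq_ltn => /orP[ij|ji].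
  apply: (@maximal_overlap_ortho _ (cos (theta i)) _ (v i)) => //.
  - exact: principal_dot uvP i.
  - by rewrite principal_right_dot -val_eqE ltn_eqF.
  move=> w /submx_trans wvv; have wN : (w <= N :&: (span_before v i)^!)%MS.
    by apply: wvv; rewrite addsmx_sub !principal_right_after // ltnW.
  have := normsq_dotmx_le (principal_left_after (leqnn i)) wN.
  by rewrite -(principal_sup uvP) unit_u mul1r.
apply: dotmx_eq0C.
apply: (@maximal_overlap_ortho _ (cos (theta j)) _ (u j)) => //.
- by rewrite dotmxC (principal_dot uvP) conjc_real.
- by rewrite principal_left_dot -val_eqE ltn_eqF.
move=> w /submx_trans wuu; have wM : (w <= M :&: (span_before u j)^!)%MS.
  by apply: wuu; rewrite addsmx_sub !principal_left_after // ltnW.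
have := normsq_dotmx_le wM (principal_right_after (leqnn j)).
by rewrite -(principal_sup uvP) unit_v mulr1 dotmxC conjcK mulrC.
Qed.

Lemma principal_dotE i j :
  dotmx (u i) (v j) = if i == j then (cos (theta i))%:C else 0.
Proof.
by case: eqVneq => [<-|/principal_dot_neq //]; exact: (principal_dot uvP).
Qed.

End PrincipalVectors.

(** * Jordan planes of subspaces in generic position *)

Section GenericPosition.
Variable R : realType.
Local Notation C := R[i].
Local Open Scope complex_scope.

Lemma orthonormal_basis_sub n q (A : 'M[C]_n) (w : 'I_q -> 'rV[C]_n) :
  \rank A = q -> (forall i, (w i <= A)%MS) ->
  (forall i j, dotmx (w i) (w j) = (i == j)%:R) ->
  (A <= \matrix_i w i)%MS.
Proof.
move=> rkA wA ww.
have WA : (\matrix_i w i <= A)%MS by apply/row_subP => i; rewrite rowK.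
rewrite -(mxrank_leqif_sup WA) rkA mxrank_unitary //.
by apply/row_unitarymxP => i j; rewrite !rowK.
Qed.

Lemma orthonormal_basis_ortho n q (A : 'M[C]_n) (w : 'I_q -> 'rV[C]_n) x :
  \rank A = q -> (forall i, (w i <= A)%MS) ->
  (forall i j, dotmx (w i) (w j) = (i == j)%:R) ->
  (forall i, dotmx x (w i) = 0) -> (x <= A^!)%MS.
Proof.
move=> rkA wA ww xw.
have WA := orthonormal_basis_sub rkA wA ww.
rewrite -submx_ortho in WA; apply: (submx_trans _ WA).
rewrite orthomx_sym; apply/row_subP => i.
by rewrite rowK orthomx_sym; apply/hermmx_eq0P; exact: xw.
Qed.

Lemma proj_orthoD n (A : 'M[C]_n) (x y : 'rV[C]_n) :
  (x <= A)%MS -> (y <= A^!)%MS -> (x + y) *m proj_ortho A = x.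
Proof.
by move=> xA yA; rewrite mulmxDl proj_ortho_id // proj_ortho_0 // addr0.
Qed.

Lemma sub_addsmx_rowP n (x y z : 'rV[C]_n) :
  (z <= x + y)%MS <-> exists a b, z = a *: x + b *: y.
Proof.
split=> [/sub_addsmxP[[a b] /= ->]|[a [b ->]]].
  exists (a 0 0), (b 0 0).
  by rewrite [a in LHS]mx11_scalar [b in LHS]mx11_scalar !mul_scalar_mx.
by rewrite addmx_sub_adds ?scalemx_sub.
Qed.

Variables (p : nat) (M N : 'M[C]_(2 * p)) (theta : 'I_p -> R).
Variables (u v : 'I_p -> 'rV[C]_(2 * p)).
Hypothesis genMN : generic_position M N.
Hypothesis uvP : principal_system M N theta u v.

Let uu := principal_left_dot uvP.
Let vv := principal_right_dot uvP.
Let uv := principal_dotE uvP.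
Let uM := principal_left_sub uvP.
Let vN := principal_right_sub uvP.

Local Notation c k := (cos (theta k)).
Local Notation s k := (sin (theta k)).

Let vu i j : dotmx (v i) (u j) = if i == j then (c i)%:C else 0.
Proof.
rewrite dotmxC uv eq_sym.
by case: eqVneq => [->|_]; rewrite ?conjc_real ?conjc0.
Qed.

Let rkN : \rank N = p. Proof. by case: (principal_rank uvP). Qed.

Lemma rank_generic_left : \rank M = p.
Proof.
case: genMN => MN0 _ _ _; have := mxrank_sum_cap M N.
rewrite MN0 mxrank0 addn0 rkN => rkMN.
have Mp : (\rank M <= p)%N.
  by rewrite -(leq_add2r p) -rkMN addnn -mul2n rank_leq_col.
by apply/eqP; rewrite eqn_leq Mp -{1}rkN; case: (principal_rank uvP).
Qed.
Let rkM := rank_generic_left.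

Lemma left_residual_ortho k : (u k - (c k)%:C *: v k <= N^!)%MS.
Proof.
apply: (orthonormal_basis_ortho rkN vN vv) => j.
rewrite linearBl linearZl_LR /= uv vv.
by case: eqVneq => _; rewrite ?mulr1 ?mulr0 subrr.
Qed.

Lemma right_residual_ortho k : (v k - (c k)%:C *: u k <= M^!)%MS.
Proof.
apply: (orthonormal_basis_ortho rkM uM uu) => j.
rewrite linearBl linearZl_LR /= vu uu.
by case: eqVneq => _; rewrite ?mulr1 ?mulr0 subrr.
Qed.

Lemma proj_principal_left k : u k *m proj_ortho N = (c k)%:C *: v k.
Proof.
rewrite -[u k in LHS](subrK ((c k)%:C *: v k)) addrC.
by rewrite proj_orthoD ?scalemx_sub // left_residual_ortho.
Qed.

Lemma proj_principal_right k : v k *m proj_ortho M = (c k)%:C *: u k.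
Proof.
rewrite -[v k in LHS](subrK ((c k)%:C *: u k)) addrC.
by rewrite proj_orthoD ?scalemx_sub // right_residual_ortho.
Qed.

(** At a right angle u k would be orthogonal to every v j, hence to N. *)
Lemma cos_principal_neq0 k : c k != 0.
Proof.
case: genMN => _ MN'0 _ _; apply/eqP => ck0.
have := left_residual_ortho k; rewrite ck0 scale0r subr0 => ukN.
have : (u k <= M :&: N^!)%MS by rewrite sub_capmx uM.
rewrite MN'0 submx0 => /eqP uk0.
by have /eqP := uu k k; rewrite uk0 linear0r eqxx eq_sym oner_eq0.
Qed.

(** The vector u k - cos (theta k) v k has squared norm sin^2 (theta k), so a
    zero angle would put u k in N. *)
Lemma sin_principal_neq0 k : s k != 0.
Proof.
case: genMN => MN0 _ _ _; apply/eqP => sk0.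
have ck1 : c k ^+ 2 = 1 by rewrite -(cos2Dsin2 (theta k)) sk0 expr0n addr0.
have residual0 : u k - (c k)%:C *: v k = 0.
  have /orthomx_dotP resN := left_residual_ortho k.
  suff /eqP : dotmx (u k - (c k)%:C *: v k) (u k - (c k)%:C *: v k) = 0.
    by rewrite dnorm_eq0 => /eqP.
  rewrite linearBr /= [X in _ - X]resN ?scalemx_sub // subr0.
  rewrite linearBl linearZl_LR /=.
  by rewrite uu vu eqxx -rmorphM -expr2 ck1 subrr.
have : (u k <= M :&: N)%MS.
  by rewrite sub_capmx uM (subr0_eq residual0) scalemx_sub.
rewrite MN0 submx0 => /eqP uk0.
by have /eqP := uu k k; rewrite uk0 linear0r eqxx eq_sym oner_eq0.
Qed.

Lemma jordan_plane_ortho k l : k != l ->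
  (jordan_plane u v k <= (jordan_plane u v l)^!)%MS.
Proof.
move=> kl; apply/orthomx_dotP => x y /sub_addsmx_rowP[a [b ->]].
move=> /sub_addsmx_rowP[a' [b' ->]].
by rewrite dotmx_lincombl !dotmx_lincombr uu uv vu vv (negbTE kl)
  !mulr0 !addr0 !mulr0 addr0.
Qed.

(** The planes contain M and N, whose sum is direct, of dimension p + p. *)
Lemma jordan_planes_sum : (1%:M <= \sum_k jordan_plane u v k)%MS.
Proof.
case: genMN => MN0 _ _ _.
have full : (1%:M <= M + N)%MS.
  have := mxrank_sum_cap M N; rewrite MN0 mxrank0 addn0 rkN rkM => rkMN.
  by rewrite sub1mx /row_full rkMN addnn -mul2n.
apply: submx_trans full _; rewrite addsmx_sub.
have uJ k : (u k <= \sum_k jordan_plane u v k)%MS.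
  by rewrite (sumsmx_sup k) // addsmxSl.
have vJ k : (v k <= \sum_k jordan_plane u v k)%MS.
  by rewrite (sumsmx_sup k) // addsmxSr.
apply/andP; split.
  apply: submx_trans (orthonormal_basis_sub rkM uM uu) _.
  by apply/row_subP => k; rewrite rowK.
apply: submx_trans (orthonormal_basis_sub rkN vN vv) _.
by apply/row_subP => k; rewrite rowK.
Qed.

Local Notation f := (mulmxr (proj_ortho M) \o mulmxr (proj_ortho N)).

Lemma proj_comp_jordan_plane k (a b : C) :
  f (a *: u k + b *: v k) = ((a * (c k)%:C + b) * (c k)%:C) *: u k.
Proof.
rewrite /= mulmxDl -!scalemxAl proj_principal_left (proj_ortho_id (vN k)).
rewrite scalerA -scalerDl.
by rewrite -scalemxAl proj_principal_right scalerA.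
Qed.

Lemma proj_comp_stable k (x : 'rV[C]_(2 * p)) :
  (x <= jordan_plane u v k)%MS -> (f x <= jordan_plane u v k)%MS.
Proof.
move=> /sub_addsmx_rowP[a [b ->]]; rewrite proj_comp_jordan_plane.
by rewrite scalemx_sub // addsmxSl.
Qed.

(** With c = cos (theta k) and s = sin (theta k), the numbers
    alpha = a + b c and beta = b s are the coordinates of a u_k + b v_k in the
    orthonormal basis of u_k and (v_k - c u_k) / s. *)
Lemma numerical_range_jordan_plane k :
  numerical_range f (jordan_plane u v k) = elliptical_disk (c k) (s k).
Proof.
have cs : c k ^+ 2 + s k ^+ 2 = 1 by exact: cos2Dsin2.
have csC : (s k)%:C ^+ 2 = 1 - (c k)%:C ^+ 2.
  apply/eqP; rewrite eq_sym subr_eq -!rmorphXn -rmorphD addrC cs.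
  by rewrite rmorph1.
have c0 := cos_principal_neq0 k; have s0 := sin_principal_neq0 k.
have sC0 : (s k)%:C != 0 by rewrite fmorph_eq0.
have conjcMr (b : C) (r : R) : conjc (b * r%:C) = conjc b * r%:C.
  by rewrite rmorphM /= oppr0.
have conjcDr (a b : C) : conjc (a + b) = conjc a + conjc b by rewrite rmorphD.
have normE (a b : C) (x := a *: u k + b *: v k)
    (alpha := a + b * (c k)%:C) (beta := b * (s k)%:C) :
    dotmx x x = alpha * conjc alpha + beta * conjc beta.
  rewrite /x /alpha /beta dotmx_lincombl !dotmx_lincombr uu vv uv vu eqxx.
  rewrite !conjcDr !conjcMr mulr1n; ring: csC.
have rangeE (a b : C) (x := a *: u k + b *: v k)
    (alpha := a + b * (c k)%:C) (beta := b * (s k)%:C) :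
    dotmx (f x) x =
      (c k)%:C * ((c k)%:C * alpha + (s k)%:C * beta) * conjc alpha.
  rewrite /x /alpha /beta proj_comp_jordan_plane linearZl_LR /=.
  rewrite dotmx_lincombr uu uv eqxx conjcDr conjcMr mulr1n; ring: csC.
apply/seteqP; split=> [_ [x [/sub_addsmx_rowP[a [b ->]] ux] <-]|z].
  apply/elliptical_diskP => //.
  by exists (a + b * (c k)%:C), (b * (s k)%:C); rewrite -normE -rangeE.
move=> /elliptical_diskP[] // alpha [beta [ab1 ->]].
pose b := beta / (s k)%:C; pose a := alpha - b * (c k)%:C.
have alphaE : alpha = a + b * (c k)%:C by rewrite subrK.
have betaE : beta = b * (s k)%:C by rewrite divfK.
exists (a *: u k + b *: v k); last by rewrite rangeE -alphaE -betaE.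
split; first by apply/sub_addsmx_rowP; exists a, b.
by rewrite /unit_vector normE -alphaE -betaE.
Qed.

End GenericPosition.

(** * The numerical range of a product of two projections *)

Theorem theorem3p5 (R : realType) (p : nat) (M N : 'M[R[i]]_(2 * p))
    (theta : 'I_p -> R) (u v : 'I_p -> 'rV[R[i]]_(2 * p)) :
  generic_position M N ->
  principal_system M N theta u v ->
  let P := mulmxr (proj_ortho M) : 'rV[R[i]]_(2 * p) -> 'rV[R[i]]_(2 * p) in
  let Q := mulmxr (proj_ortho N) : 'rV[R[i]]_(2 * p) -> 'rV[R[i]]_(2 * p) in
  let J := jordan_plane u v in
  let lambda k := cos (theta k) in
  let mu k := sin (theta k) in
  [/\ forall k, numerical_range (P \o Q) (J k)
                = elliptical_disk (lambda k) (mu k),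
      numerical_range (P \o Q) 1%:M
        = convex_hull (\bigcup_k numerical_range (P \o Q) (J k))
    & convex_hull (\bigcup_k numerical_range (P \o Q) (J k))
        = convex_hull (\bigcup_k elliptical_disk (lambda k) (mu k))].
Proof.
move=> genMN uvP P Q J lambda mu.
have ranges k : numerical_range (P \o Q) (J k) =
    elliptical_disk (lambda k) (mu k).
  exact: (numerical_range_jordan_plane genMN uvP).
split=> //; last by congr convex_hull; apply: eq_bigcupr => k _; exact: ranges.
apply: numerical_range_orthogonal_sum.
- exact: (jordan_plane_ortho uvP).
- exact: (proj_comp_stable genMN uvP).
- exact: (jordan_planes_sum genMN uvP).
- by move=> k; rewrite ranges; exact: convex_elliptical_disk.
Qed.
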